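(* Let $G$ be a finite abelian group, let $p$ be the smallest prime divisor of $|G|$, let $\Bbbk$ be an algebraically closed field of characteristic $0$ and let $\triangleleft$ be an action of $C_p$ on $G$. If $|G|$ is odd, or if $G$ is a $2$-group and either the $C_2$-action is trivial or $G$ is an elementary $2$-group, then there exists a $C_p$-isomorphism $$H^2_c(\triangleleft)\simeq H^2(C_p,\widehat G,\bullet)\times H^2_N(G,\Bbbk^\times).$$
   Context: $C_p=\langle t\rangle$ is cyclic of order $p$; an action $\triangleleft$ of $C_p$ on $G$ is a right action by group automorphisms. $C_p$ acts on functions by $(y.\phi)(x_1,\dots,x_n,a_1,\dots,a_m)=\phi(x_1,\dots,x_n,a_1\triangleleft y,\dots,a_m\triangleleft y)$ for $y,x_i\in C_p$, $a_j\in G$. A $C_p$-isomorphism is an isomorphism of $\mathbb{Z}C_p$-modules. $Z^2_c(\triangleleft)$ is the group (pointwise product) of functions $\tau:C_p\times G\times G\to\Bbbk^{\times}$, written $\tau(x)=\tau(x,\cdot,\cdot)$, such that each $\tau(x)$ is a $2$-cocycle of $G$ with values in $\Bbbk^\times$ (trivial $G$-action) and $\tau(xy)=\tau(x)(x.\tau(y))$ for all $x,y\in C_p$. $B^2_c(\triangleleft)$ is the group of functions $\delta_G\eta$, $(\delta_G\eta)(x,a,b)=\eta(x,a)\eta(x,b)\eta(x,ab)^{-1}$, where $\eta:C_p\times G\to\Bbbk^\times$ satisfies $\eta(xy)=\eta(x)(x.\eta(y))$. $H^2_c(\triangleleft)=Z^2_c(\triangleleft)/B^2_c(\triangleleft)$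 (also denoted $H^2_c(\Bbbk C_p,\Bbbk^G,\triangleleft)$). $\widehat G=\mathrm{Hom}(G,\Bbbk^\times)$ with the action $(x.\chi)(a)=\chi(a\triangleleft x)$, denoted $\bullet$; $H^2(C_p,\widehat G,\bullet)$ is the second group cohomology. $H^2(G,\Bbbk^\times)$ is the second cohomology of $G$ with trivial action on $\Bbbk^\times$, with $C_p$ acting via $(x.s)(a,b)=s(a\triangleleft x,b\triangleleft x)$. For a $\mathbb{Z}C_p$-module $M$, $N:M\to M$ is $N(m)=(1+t+\dots+t^{p-1}).m$, and $M_N=\ker N$; $H^2_N(G,\Bbbk^\times)=H^2(G,\Bbbk^\times)_N$. *)

(* Defs.v *)
From HB Require Import structures.
From mathcomp Require Import all_boot all_order all_algebra all_fingroup.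
From mathcomp Require Import all_solvable.
From mathcomp Require Import boolp.

Set Implicit Arguments.
Unset Strict Implicit.
Unset Printing Implicit Defensive.

Import GRing.Theory.
Local Open Scope ring_scope.
Local Open Scope quotient_scope.

(* repr is also a set representative in fingroup. *)
Local Notation repr := generic_quotient.repr.

(* The multiplicative group of a field. Coefficient groups are zmodTypes, so it
   is written additively: u + v, - u and 0 denote uv, u^-1 and 1. *)
Record kunit (k : fieldType) := Kunit { kval :> k; _ : kval != 0 }.

Section Kunit.
Variable k : fieldType.
Implicit Types u v w : kunit k.

HB.instance Definition _ := [isSub for @kval k].
HB.instance Definition _ := [Choice of kunit k by <:].

Definition kone : kunit k := Kunit (oner_neq0 k).
Lemma kmul_subproof u v : val u * val v != 0.
Proof. by rewrite mulf_neq0 ?(valP u) ?(valP v). Qed.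
Definition kmul u v : kunit k := Kunit (kmul_subproof u v).
Lemma kinv_subproof u : (val u)^-1 != 0.
Proof. by rewrite invr_neq0 ?(valP u). Qed.
Definition kinv u : kunit k := Kunit (kinv_subproof u).

Lemma kmulA : associative kmul.
Proof. by move=> u v w; apply: val_inj; rewrite /= mulrA. Qed.
Lemma kmulC : commutative kmul.
Proof. by move=> u v; apply: val_inj; rewrite /= mulrC. Qed.
Lemma kmul1 : left_id kone kmul.
Proof. by move=> u; apply: val_inj; rewrite /= mul1r. Qed.
Lemma kmulV : left_inverse kone kinv kmul.
Proof. by move=> u; apply: val_inj; rewrite /= mulVf ?(valP u). Qed.

HB.instance Definition _ :=
  GRing.isZmodule.Build (kunit k) kmulA kmulC kmul1 kmulV.

End Kunit.

(* Left ZC-modules for a finite group C. *)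
Record gmodule (cT : finGroupType) := GModule {
  gmsort :> zmodType;
  gmact : cT -> gmsort -> gmsort;
  gmact1 : forall m, gmact 1%g m = m;
  gmactM : forall x y m, gmact (x * y)%g m = gmact x (gmact y m);
  gmactD : forall x, {morph gmact x : m n / m + n}
}.
Arguments gmact {cT g} x m.
Notation "x ∙ m" := (gmact x m) (at level 35, right associativity).

Definition gmod_isomorphic (cT : finGroupType) (M N : gmodule cT) : Prop :=
  exists f : {additive M -> N},
    bijective f /\ forall (x : cT) (m : M), f (x ∙ m) = x ∙ f m.

Section GModuleTheory.
Variables (cT : finGroupType) (M : gmodule cT).
Implicit Types (x : cT) (m n : M).

Lemma gmact0 x : x ∙ (0 : M) = 0.
Proof. by apply: (addrI (x ∙ (0 : M))); rewrite -gmactD !addr0. Qed.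
Lemma gmactN x m : x ∙ (- m) = - (x ∙ m).
Proof. by apply: (addrI (x ∙ m)); rewrite -gmactD !subrr gmact0. Qed.
Lemma gmactB x m n : x ∙ (m - n) = x ∙ m - x ∙ n.
Proof. by rewrite gmactD gmactN. Qed.
Lemma gmact_sum x I (r : seq I) (P : pred I) (F : I -> M) :
  x ∙ (\sum_(i <- r | P i) F i) = \sum_(i <- r | P i) x ∙ F i.
Proof. by apply: big_morph; [exact: gmactD | exact: gmact0]. Qed.

End GModuleTheory.

Section TrivialModule.
Variables (cT : finGroupType) (V : zmodType).
Definition gmod_triv : gmodule cT :=
  @GModule cT V (fun _ v => v) (fun _ => erefl) (fun _ _ _ => erefl)
           (fun _ _ _ => erefl).
End TrivialModule.

Section ProductModule.
Variables (cT : finGroupType) (M N : gmodule cT).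
Definition prod_act (x : cT) (u : M * N) : M * N := (x ∙ u.1, x ∙ u.2).
Lemma prod_act1 u : prod_act 1 u = u.
Proof. by case: u => m n; rewrite /prod_act /= !gmact1. Qed.
Lemma prod_actM x y u : prod_act (x * y) u = prod_act x (prod_act y u).
Proof. by rewrite /prod_act /= !gmactM. Qed.
Lemma prod_actD x : {morph prod_act x : u v / u + v}.
Proof. by move=> u v; rewrite /prod_act /= !gmactD. Qed.
Definition gmod_prod : gmodule cT :=
  @GModule cT (M * N)%type prod_act prod_act1 prod_actM prod_actD.
End ProductModule.

Section PointwiseModule.
Variables (cT : finGroupType) (I : finType) (M : gmodule cT).
Definition ffun_act (y : cT) (f : {ffun I -> M}) : {ffun I -> M} :=
  [ffun i => y ∙ f i].
Lemma ffun_act1 f : ffun_act 1 f = f.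
Proof. by apply/ffunP=> i; rewrite ffunE gmact1. Qed.
Lemma ffun_actM x y f : ffun_act (x * y) f = ffun_act x (ffun_act y f).
Proof. by apply/ffunP=> i; rewrite !ffunE gmactM. Qed.
Lemma ffun_actD x : {morph ffun_act x : f g / f + g}.
Proof. by move=> f g; apply/ffunP=> i; rewrite !ffunE gmactD. Qed.
Definition gmod_ffun : gmodule cT :=
  @GModule cT {ffun I -> M} ffun_act ffun_act1 ffun_actM ffun_actD.
End PointwiseModule.

(* A right action of C on X yields the left action (y . phi)(a) = phi(a <| y)
   on functions. *)
Section PrecompModule.
Variables (cT : finGroupType) (X : finType) (to : {action cT &-> X}).
Variable V : zmodType.
Definition precomp_act (y : cT) (f : {ffun X -> V}) : {ffun X -> V} :=
  [ffun a => f (to a y)].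
Lemma precomp_act1 f : precomp_act 1 f = f.
Proof. by apply/ffunP=> a; rewrite ffunE act1. Qed.
Lemma precomp_actM x y f :
  precomp_act (x * y) f = precomp_act x (precomp_act y f).
Proof. by apply/ffunP=> a; rewrite !ffunE actM. Qed.
Lemma precomp_actD x : {morph precomp_act x : f g / f + g}.
Proof. by move=> f g; apply/ffunP=> a; rewrite !ffunE. Qed.
Definition gmod_precomp : gmodule cT :=
  @GModule cT {ffun X -> V} precomp_act precomp_act1 precomp_actM precomp_actD.
End PrecompModule.

Section PairAction.
Variables (cT : finGroupType) (X : finType) (to : {action cT &-> X}).
Definition pair_act (u : X * X) (y : cT) : X * X := (to u.1 y, to u.2 y).
Lemma pair_act1 : pair_act^~ 1%g =1 id.
Proof. by case=> a b; rewrite /pair_act /= !act1. Qed.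
Lemma pair_actM u : act_morph pair_act u.
Proof. by move=> x y; rewrite /pair_act /= !actM. Qed.
Definition pair_action : {action cT &-> X * X} :=
  TotalAction pair_act1 pair_actM.
End PairAction.

Section Submodule.
Variables (cT : finGroupType) (V : gmodule cT) (Z : zmodClosed V).

Record submod := Submod { submod_val :> V; _ : submod_val \in Z }.
HB.instance Definition _ := [isSub for submod_val].
HB.instance Definition _ := [Choice of submod by <:].
HB.instance Definition _ := [SubChoice_isSubZmodule of submod by <:].

Hypothesis Zact : forall x v, v \in Z -> x ∙ v \in Z.
Definition submod_act (x : cT) (z : submod) : submod :=
  Submod (Zact x (valP z)).
Lemma submod_act1 z : submod_act 1 z = z.
Proof. by apply: val_inj; rewrite /= gmact1. Qed.
Lemma submod_actM x y z : submod_act (x * y) z = submod_act x (submod_act y z).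
Proof. by apply: val_inj; rewrite /= gmactM. Qed.
Lemma submod_actD x : {morph submod_act x : u v / u + v}.
Proof. by move=> u v; apply: val_inj; rewrite /= gmactD. Qed.
Definition gmod_sub : gmodule cT :=
  @GModule cT submod submod_act submod_act1 submod_actM submod_actD.
End Submodule.

Section QuotientModule.
Variables (cT : finGroupType) (V : gmodule cT) (B : zmodClosed V).
Hypothesis Bact : forall x v, v \in B -> x ∙ v \in B.
Local Notation Q := {ideal_quot B}.
Definition quot_act (x : cT) (q : Q) : Q := \pi_Q (x ∙ repr q).

Lemma quot_act_pi x v : quot_act x (\pi_Q v) = \pi_Q (x ∙ v).
Proof.
apply/eqP; rewrite /quot_act -Quotient.idealrBE -gmactB Bact //.
by rewrite Quotient.idealrBE reprK.
Qed.
Lemma quot_act1 q : quot_act 1 q = q.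
Proof. by rewrite -[q]reprK quot_act_pi gmact1. Qed.
Lemma quot_actM x y q : quot_act (x * y) q = quot_act x (quot_act y q).
Proof. by rewrite -[q]reprK (quot_act_pi y) !quot_act_pi gmactM. Qed.
Lemma quot_actD x : {morph quot_act x : p q / p + q}.
Proof.
have piD u v : \pi_Q (u + v) = \pi_Q u + \pi_Q v by rewrite !piE.
by move=> p q; rewrite -[p]reprK -[q]reprK -piD !quot_act_pi gmactD piD.
Qed.
Definition gmod_quot : gmodule cT :=
  @GModule cT Q quot_act quot_act1 quot_actM quot_actD.
End QuotientModule.

Section Subquotient.
Variables (cT : finGroupType) (V : gmodule cT) (Z B : zmodClosed V).
Hypothesis Zact : forall x v, v \in Z -> x ∙ v \in Z.
Hypothesis Bact : forall x v, v \in B -> x ∙ v \in B.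

Definition relpred : {pred gmod_sub Zact} := fun z => submod_val z \in B.
Lemma relpred_zmod_closed : zmod_closed relpred.
Proof.
split=> [|u v uB vB]; first exact: (rpred0 B).
exact: (rpredB (uB : val u \in B) (vB : val v \in B)).
Qed.
HB.instance Definition _ :=
  GRing.isZmodClosed.Build (gmod_sub Zact) relpred relpred_zmod_closed.
Lemma relpred_act x z : z \in relpred -> x ∙ z \in relpred.
Proof. exact: Bact. Qed.

(* Z / (B :&: Z); in all uses below B is contained in Z (coboundary2_sub and
   B2c_sub). *)
Definition gmod_subquot : gmodule cT := gmod_quot relpred_act.
End Subquotient.

Section GroupCohomology.
Variables (cT : finGroupType) (M : gmodule cT).
Implicit Types (f : {ffun cT -> M}) (s : {ffun cT * cT -> M}).

Definition cocycle1 : {pred {ffun cT -> M}} :=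
  fun f => [forall x, forall y, f (x * y)%g == f x + x ∙ f y].

Definition cocycle2 : {pred {ffun cT * cT -> M}} :=
  fun s => [forall x, forall y, forall z,
    x ∙ s (y, z) + s (x, (y * z)%g) == s ((x * y)%g, z) + s (x, y)].

Definition cobound f : {ffun cT * cT -> M} :=
  [ffun u => u.1 ∙ f u.2 - f (u.1 * u.2)%g + f u.1].

Definition coboundary2 : {pred {ffun cT * cT -> M}} :=
  fun s => `[< exists f, s = cobound f >].

Lemma cocycle1P f :
  reflect (forall x y, f (x * y)%g = f x + x ∙ f y) (f \in cocycle1).
Proof.
apply: (iffP forallP) => [h x y | h x]; first exact/eqP/(forallP (h x)).
by apply/forallP=> y; apply/eqP.
Qed.

Lemma cocycle2P s :
  reflect (forall x y z,
    x ∙ s (y, z) + s (x, (y * z)%g) = s ((x * y)%g, z) + s (x, y))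
  (s \in cocycle2).
Proof.
apply: (iffP forallP) => [h x y z | h x].
  by apply/eqP; move/forallP: (h x) => /(_ y) /forallP.
by apply/forallP=> y; apply/forallP=> z; apply/eqP.
Qed.

Lemma coboundary2P s : reflect (exists f, s = cobound f) (s \in coboundary2).
Proof. exact: asboolP. Qed.

Lemma cocycle1_zmod_closed : zmod_closed cocycle1.
Proof.
split=> [|f g /cocycle1P hf /cocycle1P hg]; apply/cocycle1P=> x y.
  by rewrite !ffunE gmact0 addr0.
by rewrite !ffunE hf hg gmactB opprD addrACA.
Qed.
HB.instance Definition _ :=
  GRing.isZmodClosed.Build {ffun cT -> M} cocycle1 cocycle1_zmod_closed.

Lemma cocycle2_zmod_closed : zmod_closed cocycle2.
Proof.
split=> [|f g /cocycle2P hf /cocycle2P hg]; apply/cocycle2P=> x y z.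
  by rewrite !ffunE gmact0.
by rewrite !ffunE gmactB addrACA hf -opprD hg opprD addrACA.
Qed.
HB.instance Definition _ :=
  GRing.isZmodClosed.Build {ffun cT * cT -> M} cocycle2 cocycle2_zmod_closed.

Lemma coboundB f g : cobound (f - g) = cobound f - cobound g.
Proof.
apply/ffunP=> -[x y]; rewrite !ffunE /= gmactB.
by rewrite !opprD (addrACA (x ∙ f y)) [LHS]addrACA.
Qed.
Lemma cobound0 : cobound 0 = 0.
Proof. by rewrite -(subrr 0) coboundB subrr. Qed.
Lemma coboundD f g : cobound (f + g) = cobound f + cobound g.
Proof.
by rewrite -[in LHS](opprK g) -[- g]sub0r !coboundB cobound0 sub0r opprK.
Qed.

Lemma coboundary2_zmod_closed : zmod_closed coboundary2.
Proof.
split=> [|_ _ /coboundary2P[f ->] /coboundary2P[g ->]]; apply/coboundary2P.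
  by exists 0; rewrite cobound0.
by exists (f - g); rewrite coboundB.
Qed.
HB.instance Definition _ :=
  GRing.isZmodClosed.Build {ffun cT * cT -> M} coboundary2
    coboundary2_zmod_closed.

Lemma cobound_cocycle2 f : cobound f \in cocycle2.
Proof.
apply/cocycle2P=> x y z; rewrite !ffunE /= !gmactD gmactN -gmactM !mulgA.
set A := (x * y)%g ∙ f z; set D := x ∙ f y; set E := x ∙ f (y * z)%g.
rewrite -!addrA; congr (A + _).
by rewrite [LHS]addrCA addKr [in RHS](addrCA D) addNKr addrCA.
Qed.
Lemma coboundary2_sub : {subset coboundary2 <= cocycle2}.
Proof. by move=> _ /coboundary2P[f ->]; exact: cobound_cocycle2. Qed.

End GroupCohomology.
Arguments cocycle1 {cT} M _.
Arguments cocycle2 {cT} M _.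
Arguments coboundary2 {cT} M _.
Arguments cobound {cT} M f.

(* H^2(C, M) for abelian C, with the C-action (y.s)(x1, x2) = y.s(x1, x2). *)
Section CohomologyCoefAction.
Variables (cT : finGroupType) (cC : commutative (@mulg cT)) (M : gmodule cT).
Let V := gmod_ffun (cT * cT)%type M.

Lemma coef_act_cocycle2 y (s : V) : s \in cocycle2 M -> y ∙ s \in cocycle2 M.
Proof.
move=> /cocycle2P hs; apply/cocycle2P=> x1 x2 x3.
by rewrite !ffunE -gmactM cC gmactM -!gmactD hs.
Qed.
Lemma coef_act_coboundary2 y (s : V) :
  s \in coboundary2 M -> y ∙ s \in coboundary2 M.
Proof.
move=> /coboundary2P[f ->]; apply/coboundary2P; exists [ffun x => y ∙ f x].
by apply/ffunP=> u; rewrite !ffunE gmactD gmactB -!gmactM cC.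
Qed.
Definition H2_coef : gmodule cT :=
  @gmod_subquot cT V (cocycle2 M) (coboundary2 M)
    coef_act_cocycle2 coef_act_coboundary2.
End CohomologyCoefAction.

(* A function tau on C x G x G is curried: tau x (a, b). *)
Section MatchedCohomology.
Variables (k : fieldType) (cT gT : finGroupType).
Variable to : groupAction [set: cT] [set: gT].

Definition ktriv : gmodule gT := gmod_triv gT (kunit k).
Definition funG : gmodule cT := gmod_precomp to (kunit k).
Definition funGG : gmodule cT := gmod_precomp (pair_action to) (kunit k).
Definition funCGG : gmodule cT := gmod_ffun cT funGG.

Lemma gactmM a b x : to (a * b)%g x = (to a x * to b x)%g.
Proof. by apply: (gactM (D := [set: cT]) (R := [set: gT])); rewrite ?inE. Qed.

(* The characters Hom(G, k^x) inside the functions on G. *)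
Definition charpred : {pred funG} :=
  fun chi => [forall a, forall b, chi (a * b)%g == chi a + chi b].
Lemma charP (chi : funG) :
  reflect (forall a b, chi (a * b)%g = chi a + chi b) (chi \in charpred).
Proof.
apply: (iffP forallP) => [h a b | h a]; first exact/eqP/(forallP (h a)).
by apply/forallP=> b; apply/eqP.
Qed.
Lemma charpred_zmod_closed : zmod_closed charpred.
Proof.
split=> [|f g /charP hf /charP hg]; apply/charP=> a b.
  by rewrite !ffunE addr0.
by rewrite !ffunE hf hg opprD addrACA.
Qed.
HB.instance Definition _ :=
  GRing.isZmodClosed.Build funG charpred charpred_zmod_closed.
Lemma charpred_act y chi : chi \in charpred -> y ∙ chi \in charpred.
Proof. by move=> /charP h; apply/charP=> a b; rewrite !ffunE gactmM h. Qed.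

Definition dualG : gmodule cT := gmod_sub charpred_act.

Lemma funGG_act_cocycle2 y (s : funGG) :
  s \in cocycle2 ktriv -> y ∙ s \in cocycle2 ktriv.
Proof.
move=> /cocycle2P hs; apply/cocycle2P=> a b c.
by rewrite !ffunE /= /pair_act /= !gactmM; apply: hs.
Qed.
Lemma cobound_act y (f : funG) :
  cobound ktriv (y ∙ f) = y ∙ (cobound ktriv f : funGG).
Proof. by apply/ffunP=> -[a b]; rewrite !ffunE /= /pair_act /= gactmM. Qed.
Lemma funGG_act_coboundary2 y (s : funGG) :
  s \in coboundary2 ktriv -> y ∙ s \in coboundary2 ktriv.
Proof.
move=> /coboundary2P[f ->]; apply/coboundary2P.
by exists (y ∙ (f : funG)); rewrite cobound_act.
Qed.

Definition Z2G : zmodClosed funGG :=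
  (cocycle2 ktriv : zmodClosed {ffun gT * gT -> ktriv}).
Definition B2G : zmodClosed funGG :=
  (coboundary2 ktriv : zmodClosed {ffun gT * gT -> ktriv}).

Definition H2G : gmodule cT :=
  @gmod_subquot cT funGG Z2G B2G
    funGG_act_cocycle2 funGG_act_coboundary2.

(* tau (xy) = tau x . (x.tau y) says that tau is a 1-cocycle of C with values in
   the functions on G x G; likewise for eta in B2c. *)
Definition Z2c : {pred funCGG} :=
  fun tau => (tau \in cocycle1 funGG) && [forall x, tau x \in cocycle2 ktriv].

Definition delta (eta : {ffun cT -> funG}) : funCGG :=
  [ffun x => cobound ktriv (eta x)].
Definition B2c : {pred funCGG} :=
  fun tau => `[< exists2 eta, eta \in cocycle1 funG & tau = delta eta >].

Lemma Z2c_zmod_closed : zmod_closed Z2c.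
Proof.
split=> [|f g /andP[hf /forallP hf'] /andP[hg /forallP hg']]; apply/andP.
  split; first exact: (rpred0 (cocycle1 funGG)).
  by apply/forallP=> x; rewrite ffunE; exact: (rpred0 (cocycle2 ktriv)).
split; first exact: (rpredB hf hg).
by apply/forallP=> x; rewrite !ffunE; exact: (rpredB (hf' x) (hg' x)).
Qed.
HB.instance Definition _ :=
  GRing.isZmodClosed.Build funCGG Z2c Z2c_zmod_closed.

Lemma deltaB f g : delta (f - g) = delta f - delta g.
Proof.
by apply/ffunP=> x; rewrite !ffunE -(coboundB (M := ktriv)).
Qed.
Lemma B2c_zmod_closed : zmod_closed B2c.
Proof.
split=> [|_ _ /asboolP[f hf ->] /asboolP[g hg ->]]; apply/asboolP.
  exists 0; first exact: rpred0.
  by rewrite -[X in delta X](subrr 0) deltaB subrr.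
by exists (f - g); rewrite ?deltaB ?rpredB.
Qed.
HB.instance Definition _ :=
  GRing.isZmodClosed.Build funCGG B2c B2c_zmod_closed.

Lemma B2c_sub : {subset B2c <= Z2c}.
Proof.
move=> _ /asboolP[eta /cocycle1P h ->]; apply/andP; split.
  apply/cocycle1P=> x y; rewrite !ffunE -cobound_act h.
  exact: (coboundD (M := ktriv)).
by apply/forallP=> x; rewrite ffunE; exact: cobound_cocycle2.
Qed.

Hypothesis cC : commutative (@mulg cT).

Lemma cocycle1_act (M : gmodule cT) y (f : gmod_ffun cT M) :
  f \in cocycle1 M -> y ∙ f \in cocycle1 M.
Proof.
move=> /cocycle1P h; apply/cocycle1P=> x z.
by rewrite !ffunE h gmactD -!gmactM cC.
Qed.
Lemma Z2c_act y tau : tau \in Z2c -> y ∙ tau \in Z2c.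
Proof.
move=> /andP[h /forallP h']; apply/andP; split; first exact: cocycle1_act.
by apply/forallP=> x; rewrite ffunE; exact: funGG_act_cocycle2.
Qed.
Lemma B2c_act y tau : tau \in B2c -> y ∙ tau \in B2c.
Proof.
move=> /asboolP[eta h ->]; apply/asboolP.
exists (y ∙ (eta : gmod_ffun cT funG)); first exact: cocycle1_act.
by apply/ffunP=> x; rewrite !ffunE cobound_act.
Qed.

Definition H2c : gmodule cT :=
  @gmod_subquot cT funCGG Z2c B2c Z2c_act B2c_act.

End MatchedCohomology.

Section NormKernel.
Variables (cT : finGroupType) (t : cT) (Ct : [set: cT] = <[t]>%g).
Variable M : gmodule cT.

Lemma cyclic_mulC : commutative (@mulg cT).
Proof.
move=> x y; have: abelian [set: cT] by rewrite Ct cycle_abelian.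
by move=> /centsP; apply; rewrite inE.
Qed.

(* The norm 1 + t + ... + t^(p-1), where p is the order of C = <[t]>. *)
Definition normC (m : M) : M := \sum_(i < #[t]%g) (t ^+ i)%g ∙ m.

Definition normker : {pred M} := fun m => normC m == 0.
Lemma normker_zmod_closed : zmod_closed normker.
Proof.
split=> [|m n /eqP hm /eqP hn]; apply/eqP; rewrite /normC.
  by rewrite big1 // => i _; rewrite gmact0.
rewrite -[RHS](subrr 0) -[in X in _ = X - _]hm -[in X in _ = _ - X]hn.
by rewrite -sumrB; apply: eq_bigr => i _; rewrite gmactB.
Qed.
HB.instance Definition _ := GRing.isZmodClosed.Build M normker
    normker_zmod_closed.
Lemma normker_act x m : m \in normker -> x ∙ m \in normker.
Proof.
move=> /eqP hm; apply/eqP; rewrite -(gmact0 M x) -hm gmact_sum.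
by apply: eq_bigr => i _; rewrite -!gmactM cyclic_mulC.
Qed.
Definition gmod_normker : gmodule cT := gmod_sub normker_act.
End NormKernel.

(* Main.v *)
(* Write C = C_p = <t>, K = k^x, and N for the norm of C. An element tau of
   Z^2_c is a 1-cocycle of C with values in Z^2(G, K), so it is determined by
   s = tau(t), which is any 2-cocycle of G with N s = 0. Mapping tau to the
   class of s gives an exact sequence of C-modules
     0 -> H^2(C, Hom(G, K)) -> H^2_c -> H^2_N(G, K) -> 0.
   On the left, a tau with s a coboundary lifts to eta : C -> Map(G, K), and the
   coboundary of eta is a 2-cocycle of C with values in Hom(G, K); every class
   arises because C-invariant functions on G are norms (K is divisible), whence
   H^2(C, Map(G, K)) = 0. Surjectivity on the right: if N s = d f, the character
   t f - f vanishes on the t-fixed points of G, so by duality it is t psi - psi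
   for a character psi; then f - psi is invariant, hence a norm N h, and
   N (s - d h) = 0.
   The sequence splits. If |G| is odd, half the commutator pairing of s is a
   C-equivariant section of Z^2(G, K) -> H^2(G, K). If p = 2, then t acts by -1,
   so an additive retraction suffices, and it exists as soon as 2 kills H^2_c.
   This is clear if the action is trivial (t acts by 1 and by -1). If G is
   elementary abelian, 2 s is symmetric, so 2 s = d f, and at fixed points a of t
   N f = 2 f takes the value 2 s(a, a) = (N s)(a, a) = 0; so N f is by duality a
   norm N psi of a character, and f - psi has norm 0. *)

Require Import Defs.
From HB Require Import structures.
From mathcomp Require Import all_boot all_order all_algebra all_fingroup.
From mathcomp Require Import all_solvable.
From mathcomp Require Import boolp classical_sets.

Set Implicit Arguments.
Unset Strict Implicit.
Unset Printing Implicit Defensive.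

Import GRing.Theory.

(** * Additivity of maps that respect subtraction *)

Section AdditiveOfSub.
Local Open Scope ring_scope.
Variables (U V : zmodType) (g : U -> V).
Hypothesis gB : {morph g : u v / u - v}.

Lemma morphB0 : g 0 = 0.
Proof. by rewrite -[in LHS](subrr 0) gB subrr. Qed.

Lemma morphBN : {morph g : u / - u}.
Proof. by move=> u; rewrite -sub0r gB morphB0 sub0r. Qed.

Lemma morphBD : {morph g : u v / u + v}.
Proof. by move=> u v; rewrite -[v in LHS]opprK gB morphBN opprK. Qed.
End AdditiveOfSub.

(** * Extension of homomorphisms from subgroups *)

Section PartialHom.
Local Open Scope ring_scope.
Local Open Scope classical_set_scope.
Variables E D : zmodType.
Implicit Types S : set (E * D).

(* The graph of a homomorphism to D from a subgroup of E. *)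
Definition partial_hom S :=
  [/\ S 0, forall u v, S u -> S v -> S (u - v) & forall d, S (0, d) -> d = 0].

Lemma partial_homN S u : partial_hom S -> S u -> S (- u).
Proof. by case=> S0 SB _ Su; rewrite -sub0r; apply: SB. Qed.

Lemma partial_homD S u v : partial_hom S -> S u -> S v -> S (u + v).
Proof.
move=> hS Su Sv; case: (hS) => _ SB _.
by rewrite -[v]opprK; apply: SB => //; apply: partial_homN.
Qed.

Lemma pair_mulrn (x : E) (d : D) n : (x, d) *+ n = (x *+ n, d *+ n).
Proof. by elim: n => // n IHn; rewrite !mulrS IHn. Qed.

Lemma partial_homMn S x d n : partial_hom S -> S (x, d) -> S (x *+ n, d *+ n).
Proof.
move=> hS Su; rewrite -pair_mulrn; elim: n => [|n IHn]; first by case: hS.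
by rewrite mulrS; apply: partial_homD.
Qed.

Lemma partial_hom_inj S x d e :
  partial_hom S -> S (x, d) -> S (x, e) -> d = e.
Proof.
case=> _ SB inj0 Sd Se; apply/eqP; rewrite -subr_eq0; apply/eqP/inj0.
by have /= := SB _ _ Sd Se; rewrite -[_ - _]/(x - x, d - e) subrr.
Qed.

Lemma partial_hom_total S : partial_hom S -> (forall x, exists d, S (x, d)) ->
  exists r : E -> D, {morph r : x y / x - y} /\ forall x, S (x, r x).
Proof.
move=> hS /choice[r hr]; exists r; split=> // x y.
apply: (partial_hom_inj hS) (hr _) _.
by case: hS => _ SB _; apply: (SB _ _ (hr x) (hr y)).
Qed.

(** Adjoin all integer multiples of (x, d) to the graph. The hypothesis makes them agree with S
    wherever the domains meet, so the result is still single-valued. *)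
Lemma partial_hom_adjoin S x d : partial_hom S ->
    (forall n e, S (x *+ n, e) -> e = d *+ n) ->
  exists2 S', partial_hom S' & S `<=` S' /\ S' (x, d).
Proof.
move=> hS hd; case: (hS) => S0 SB inj0.
have hdz n e : S (x *~ n, e) -> e = d *~ n.
  case: n => n; first exact: hd.
  move=> /(partial_homN hS)/=; rewrite -[- _]/(_, _) opprK.
  by move=> /hd/(canRL (@opprK _)).
exists [set u | exists2 v, S v & exists n, u = v + (x *~ n, d *~ n)].
  split=> [|_ _ [u Su [m ->]] [v Sv [n ->]]|e [[y f] Sv [n]]].
  - by exists 0 => //; exists 0; rewrite addr0.
  - exists (u - v); first exact: SB.
    by exists (m - n); rewrite opprD addrACA !mulrzBr.
  - case=> /esym/eqP; rewrite addr_eq0 => /eqP y_eq ->.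
    have := partial_homN hS Sv; rewrite -[- _]/(- y, - f) y_eq opprK => /hdz <-.
    by rewrite subrr.
split=> [u Su|]; first by exists u => //; exists 0; rewrite addr0.
by exists 0 => //; exists 1; rewrite add0r !mulr1z.
Qed.

(** Zorn: a maximal extension is total, since it could otherwise be extended by one more point. The
    one-point step is left as a hypothesis because it is met in two ways: by divisibility of D, and
    in [retraction_two] because doubles already lie in the domain. *)
Lemma partial_hom_extend S : partial_hom S ->
    (forall S', partial_hom S' -> S `<=` S' ->
       forall x, exists d, forall n e, S' (x *+ n, e) -> e = d *+ n) ->
  exists r : E -> D,
    {morph r : x y / x - y} /\ forall x d, S (x, d) -> r x = d.
Proof.
move=> hS ext.
pose P := [set S' | S' = set0 \/ partial_hom S' /\ S `<=` S'].
have [|M [PM maxM]] := @Zorn_bigcup _ P.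
  move=> F FP Ftot.
  have [[X [FX SX]]|noX] := pselect (exists X, F X /\ partial_hom X).
    have big Y u : F Y -> Y u -> partial_hom Y /\ S `<=` Y.
      by move=> FY Yu; case: (FP Y FY) => // Y0; rewrite Y0 in Yu.
    have SsubX: S `<=` X by case: (SX) => X0 _ _; case: (big X 0 FX X0).
    right; split; last by move=> u Su; exists X => //; apply: SsubX.
    split=> [|u v [Y FY Yu] [Z FZ Zv]|d [Y FY Yd]].
    + by exists X => //; case: SX.
    + have [[_ YB _] _] := big _ _ FY Yu; have [[_ ZB _] _] := big _ _ FZ Zv.
      have [sub|sub] := Ftot Y Z FY FZ.
        by exists Z => //; apply: ZB => //; apply: sub.
      by exists Y => //; apply: YB => //; apply: sub.
    + by have [[_ _ inj0] _] := big _ _ FY Yd; apply: inj0.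
  left; rewrite -subset0 => u [X FX Xu]; apply: noX; exists X; split=> //.
  by case: (FP X FX) => [X0|[]//]; rewrite X0 in Xu.
have [hM SM]: partial_hom M /\ S `<=` M.
  case: PM => // M0; case: (maxM S); first last.
    by right; split.
  rewrite M0; split=> [//|sub]; case: hS => S0 _ _; exact: (sub 0 S0).
have Mtot x : exists d, M (x, d).
  have [d hd] := ext M hM SM x; exists d.
  have [M' hM' [MM' M'x]] := partial_hom_adjoin hM hd.
  have [//|nMx] := pselect (M (x, d)).
  case: (maxM M'); first by split=> // sub; apply/nMx/sub.
  by right; split=> //; apply: subset_trans MM'.
have [r [rB rM]] := partial_hom_total hM Mtot.
by exists r; split=> // x d /SM; apply: partial_hom_inj (rM x).
Qed.

(** If some positive multiple of x lies in the domain, all such multiples are multiples of the least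
    one m x, and x can go to any m-th part of the value there. Otherwise the value at x is free, and
    0 is taken. *)
Lemma divisible_extend S :
    (forall (d : D) n, (0 < n)%N -> exists e, e *+ n = d) -> partial_hom S ->
  exists r : E -> D,
    {morph r : x y / x - y} /\ forall x d, S (x, d) -> r x = d.
Proof.
move=> Ddiv hS; apply: partial_hom_extend => // {hS} {}S hS _ x.
have [exm|none] :=
    pselect (exists n, (0 < n)%N && `[< exists e, S (x *+ n, e) >]).
  case: (ex_minnP exm) => m /andP[m_gt0 /asboolP[e Se]] minm.
  have [d de] := Ddiv e m m_gt0; exists d => n f Sf.
  have m_dvd: (m %| n)%N.
    rewrite /dvdn -leqn0 leqNgt; apply/negP => r_gt0.
    suff: (m <= n %% m)%N by rewrite leqNgt ltn_mod m_gt0.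
    apply: minm; rewrite r_gt0; apply/asboolP; exists (f - e *+ (n %/ m)).
    case: (hS) => _ SB _; have := SB _ _ Sf (partial_homMn (n %/ m) hS Se).
    rewrite -[_ - _]/(_, _) -mulrnA mulnC {1}(divn_eq n m) mulrnDr.
    by rewrite addrC addKr.
  rewrite -(divnK m_dvd) mulnC mulrnA de; apply: (partial_hom_inj hS Sf).
  by rewrite -{1}(divnK m_dvd) mulnC mulrnA; apply: partial_homMn.
exists 0 => -[|n] e Se; first by case: hS => _ _; apply.
by case: none; exists n.+1; apply/asboolP; exists e.
Qed.
End PartialHom.

(** * Quotient modules and the first isomorphism theorem *)

Section QuotientFacts.
Local Open Scope ring_scope.
Local Open Scope quotient_scope.
Variables (cT : finGroupType) (V : gmodule cT) (B : zmodClosed V).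
Hypothesis Bact : forall x v, v \in B -> x ∙ v \in B.

Definition quot_pi (v : V) : gmod_quot Bact := \pi_{ideal_quot B} v.

Lemma quot_piB : {morph quot_pi : u v / u - v}.
Proof.
have piB u v : \pi_{ideal_quot B} (u - v) =
    \pi_{ideal_quot B} u - \pi_{ideal_quot B} v by rewrite !piE.
exact: piB.
Qed.

Lemma quot_pi_act x v : quot_pi (x ∙ v) = x ∙ quot_pi v.
Proof. exact: esym (quot_act_pi Bact x v). Qed.

Lemma quot_pi_surj q : exists v, quot_pi v = q.
Proof. by exists (generic_quotient.repr q); rewrite /quot_pi reprK. Qed.

Lemma quot_pi_eq u v : quot_pi u = quot_pi v <-> u - v \in B.
Proof. by rewrite Quotient.idealrBE; split=> [/eqP|/eqP]. Qed.

Lemma quot_pi0 : quot_pi 0 = 0.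
Proof. by rewrite -[in LHS](subrr 0) quot_piB subrr. Qed.

Lemma quot_pi_eq0 v : quot_pi v = 0 <-> v \in B.
Proof. by rewrite -quot_pi0 quot_pi_eq subr0. Qed.

Lemma quot_iso (W : gmodule cT) (g : V -> W) :
    {morph g : u v / u - v} -> (forall x v, g (x ∙ v) = x ∙ g v) ->
    (forall v, g v = 0 <-> v \in B) -> (forall w, exists v, g v = w) ->
  gmod_isomorphic (gmod_quot Bact) W.
Proof.
move=> gB g_act g0 g_surj.
pose f (q : gmod_quot Bact) : W := g (generic_quotient.repr q).
have fpi v : f (quot_pi v) = g v.
  apply/eqP; rewrite -subr_eq0 -gB; apply/eqP/g0/quot_pi_eq.
  by rewrite /quot_pi reprK.
have fB : {morph f : p q / p - q}.
  move=> p q; have [u <-] := quot_pi_surj p; have [v <-] := quot_pi_surj q.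
  by rewrite -quot_piB !fpi.
pose fM := GRing.isZmodMorphism.Build (gmod_quot Bact) W f fB.
pose F : {additive gmod_quot Bact -> W} := HB.pack f fM.
exists F; split=> [|x q]; last first.
  have [v <-] := quot_pi_surj q; rewrite -quot_pi_act.
  by rewrite -[LHS]/(f _) -[F _]/(f _) !fpi g_act.
have [h hK] := choice g_surj; exists (quot_pi \o h) => [q|w] /=.
  have [v <-] := quot_pi_surj q; rewrite fpi; apply/quot_pi_eq/g0.
  by rewrite gB hK subrr.
by rewrite fpi hK.
Qed.
End QuotientFacts.

(** * Cocycles of a cyclic group *)

Section CyclicCohomology.
Local Open Scope ring_scope.
Variables (cT : finGroupType) (t : cT) (Ct : [set: cT] = <[t]>%g).

Lemma cyclic_expP x : exists2 i, (i < #[t]%g)%N & x = (t ^+ i)%g.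
Proof.
have /cyclePmin[i lt_i x_i]: x \in <[t]>%g by rewrite -Ct inE.
by exists i.
Qed.

Lemma cyclic_ind (P : cT -> Prop) :
  P 1%g -> (forall x, P x -> P (x * t)%g) -> forall x, P x.
Proof.
move=> P1 PM x; have [i _ ->] := cyclic_expP x.
by elim: i => [|i IHi]; rewrite ?expg0 // expgSr; apply: PM.
Qed.

Lemma sum_cycle (V : zmodType) (g : cT -> V) :
  \sum_(i < #[t]%g) g (t ^+ i)%g = \sum_x g x.
Proof.
rewrite (reindex (fun i : 'I_#[t]%g => t ^+ i)%g) //=.
have hP x : {i : 'I_#[t]%g | x = (t ^+ i)%g}.
  by apply: cid; have [i lt_i ->] := cyclic_expP x; exists (Ordinal lt_i).
exists (fun x => sval (hP x)) => [i|x] _; last by rewrite -(svalP (hP x)).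
case: (hP _) => j /= /eqP; rewrite eq_expg_mod_order !modn_small //.
by move=> /eqP/esym; apply: val_inj.
Qed.

(** Put f(t^n) = v + g(1) + ... + g(t^(n-1)); this depends on t^n only, because a full period of g
    sums to 0. *)
Lemma cyclic_primitive (V : zmodType) (g : cT -> V) (v : V) : \sum_x g x = 0 ->
  exists2 f : {ffun cT -> V}, f 1%g = v & forall x, f (x * t)%g = f x + g x.
Proof.
move=> sum0; pose S n := v + \sum_(i < n) g (t ^+ i)%g.
have Sper n : S (n + #[t]%g)%N = S n.
  rewrite /S addnC big_split_ord /= sum_cycle sum0 add0r.
  by congr (_ + _); apply: eq_bigr => i _; rewrite expgD expg_order mul1g.
have Smod n : S (n %% #[t]%g)%N = S n.
  rewrite [in RHS](divn_eq n #[t]%g); elim: (n %/ _)%N => [|q IHq] //.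
  by rewrite mulSn -addnA addnC Sper.
have hP x : {i | x = (t ^+ i)%g}.
  by apply: cid; have [i _ ->] := cyclic_expP x; exists i.
pose f := [ffun x => S (sval (hP x))].
have fS n : f (t ^+ n)%g = S n.
  rewrite ffunE; case: (hP _) => j /= /eqP; rewrite eq_expg_mod_order.
  by move=> /eqP eq_nj; rewrite -Smod -eq_nj Smod.
exists f; first by rewrite -(expg0 t) fS /S big_ord0 addr0.
move=> x; have [n _ ->] := cyclic_expP x.
by rewrite -expgSr !fS /S big_ord_recr addrA.
Qed.

Variable M : gmodule cT.
Implicit Types m : M.

Lemma normC_sum m : Defs.normC t m = \sum_x x ∙ m.
Proof. exact: (sum_cycle (fun x => x ∙ m)). Qed.

Lemma normCB m n :
  Defs.normC t (m - n) = Defs.normC t m - Defs.normC t n.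
Proof.
by rewrite !normC_sum -sumrB; apply: eq_bigr => x _; rewrite gmactB.
Qed.

Lemma normC_morph (M' : gmodule cT) (g : M -> M') m :
    {morph g : u v / u - v} -> (forall x u, g (x ∙ u) = x ∙ g u) ->
  g (Defs.normC t m) = Defs.normC t (g m).
Proof.
move=> gB g_act.
rewrite /Defs.normC (big_morph g (morphBD gB) (morphB0 gB)).
by apply: eq_bigr => i _; rewrite g_act.
Qed.

Lemma act_normC x m : x ∙ Defs.normC t m = Defs.normC t m.
Proof.
rewrite !normC_sum gmact_sum [RHS](reindex_inj (mulgI x)) /=.
by apply: eq_bigr => y _; rewrite gmactM.
Qed.

Lemma cocycle1_1 f : f \in cocycle1 M -> f 1%g = 0.
Proof.
move=> /cocycle1P/(_ 1%g 1%g); rewrite mulg1 gmact1 => /esym/eqP.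
by rewrite -subr_eq0 addrK => /eqP.
Qed.

Lemma cocycle1_cycle f : f \in cocycle1 M -> Defs.normC t (f t) = 0.
Proof.
move=> hf; rewrite -(cocycle1_1 hf) -(expg_order t) /Defs.normC.
elim: #[t]%g => [|n IHn]; first by rewrite big_ord0 expg0 (cocycle1_1 hf).
by rewrite big_ord_recr /= IHn expgSr; move/cocycle1P: hf => ->.
Qed.

Lemma cocycle1_inj f g :
  f \in cocycle1 M -> g \in cocycle1 M -> f t = g t -> f = g.
Proof.
move=> hf hg eqt; apply/ffunP; apply: cyclic_ind => [|x IHx].
  by rewrite !cocycle1_1.
by move/cocycle1P: hf => ->; move/cocycle1P: hg => ->; rewrite eqt IHx.
Qed.

(** The cocycle is the primitive of x -> x m. With [cocycle1_cycle] and [cocycle1_inj], evaluation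
    at t identifies the 1-cocycles with the kernel of the norm. *)
Lemma cocycle1_of_normC0 m : Defs.normC t m = 0 ->
  exists2 f, f \in cocycle1 M & f t = m.
Proof.
rewrite normC_sum => /(cyclic_primitive 0)[f f1 fS]; exists f; last first.
  by rewrite -(mul1g t) fS f1 add0r gmact1.
apply/cocycle1P=> x; apply: cyclic_ind => [|y IHy].
  by rewrite mulg1 f1 gmact0 addr0.
by rewrite mulgA !fS IHy gmactD gmactM addrA.
Qed.

(** The class of c in H^2(C, M) = M^C / N M is that of the sum of all c(x, t). Once this sum is a
    norm N m, a cochain can be built whose coboundary agrees with c at every (x, t). *)
Lemma cocycle2_cyclic_cobound (c : {ffun cT * cT -> M}) :
    (forall m, (forall x, x ∙ m = m) -> exists n, Defs.normC t n = m) ->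
  c \in cocycle2 M -> exists f, c = cobound M f.
Proof.
move=> norm_surj /cocycle2P hc.
pose s := \sum_x c (x, t).
have s_inv x : x ∙ s = s.
  rewrite gmact_sum; apply: (addIr (\sum_y c (x, (y * t)%g))).
  rewrite -big_split /=; under eq_bigr do rewrite hc.
  rewrite big_split /= /s [X in _ = X + _](reindex_inj (mulgI x)) /=.
  by congr (_ + _); rewrite [LHS](reindex_inj (mulIg t)).
have [m Nm] := norm_surj s s_inv.
(* The initial value c(1, t) is the one that yields f(t) = m. *)
have [|f f1 fS] :=
    cyclic_primitive (c (1%g, t)) (g := fun x => x ∙ m - c (x, t)).
  by rewrite sumrB -normC_sum Nm subrr.
have ft : f t = m by rewrite -[X in f X](mul1g t) fS f1 gmact1 addrC subrK.
exists f; apply/eqP; rewrite -subr_eq0; apply/eqP/ffunP=> -[x y].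
pose e := c - cobound M f; rewrite -/e [RHS]ffunE.
have he : e \in cocycle2 M.
  by rewrite rpredB ?cobound_cocycle2 //; apply/cocycle2P.
have et z : e (z, t) = 0.
  by rewrite !ffunE /= fS ft addrAC [- (f z + _)]opprD addrA addrK subKr subrr.
(* A cocycle that vanishes at all (z, t) does not change when its second argument is multiplied by
   t. *)
have step z : e (x, (z * t)%g) = e (x, z).
  by move/cocycle2P: he => /(_ x z t); rewrite !et gmact0 !add0r.
have: e (x, t) = 0 by [].
rewrite -(mul1g t) step => ex1.
by move: y; apply: cyclic_ind => // y IHy; rewrite step.
Qed.
End CyclicCohomology.

(** * Divisibility of the multiplicative group *)

Section UnitsDivisible.
Local Open Scope ring_scope.
Variable k : closedFieldType.

Lemma kunit_val_mulrn (u : kunit k) n : val (u *+ n) = val u ^+ n.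
Proof. by elim: n => // n IHn; rewrite mulrS exprS -IHn. Qed.

Lemma kunit_divisible (u : kunit k) n : (0 < n)%N -> exists v, v *+ n = u.
Proof.
move=> n_gt0.
(* x is a root of X^n - u. *)
have [x] := @solve_monicpoly k n (fun i => if i == 0%N then val u else 0) n_gt0.
rewrite (bigD1 (Ordinal n_gt0)) //= expr0 mulr1 big1 ?addr0 => [xn|i ni0].
  have x0 : x != 0.
    apply: contraNneq (valP u) => x0.
    by rewrite /= -xn x0 expr0n -leqn0 leqNgt n_gt0.
  by exists (Kunit x0); apply: val_inj; rewrite kunit_val_mulrn.
by rewrite (negPf (_ : nat_of_ord i != 0%N)) ?mul0r.
Qed.
End UnitsDivisible.

(** * Invariant functions are norms *)

Section NormOfFunctions.
Local Open Scope ring_scope.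
Variables (cT : finGroupType) (t : cT) (Ct : [set: cT] = <[t]>%g).
Variables (X : finType) (to : {action cT &-> X}) (V : zmodType).
Hypothesis Vdiv : forall (v : V) n, (0 < n)%N -> exists w, w *+ n = v.

(* A root of the invariant value on each orbit, put at one point of it: its
   order is the number of times that point occurs in the norm. *)
Lemma norm_precomp_surj (f : gmod_precomp to V) : (forall x, x ∙ f = f) ->
  exists h, Defs.normC t h = f.
Proof.
move=> f_inv.
have fE a x : f (to a x) = f a by rewrite -[in RHS](f_inv x) ffunE.
(* The choice depends on the orbit only, so [rep] is constant on orbits; the default is never
   reached, since a lies in its own orbit. *)
pose rep a := odflt a [pick b in orbit to [set: cT] a].
have rep_orbit a : rep a \in orbit to [set: cT] a.
  rewrite /rep; case: pickP => [//|/(_ a)]; by rewrite orbit_refl.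
have repE a x : rep (to a x) = rep a.
  rewrite /rep; have -> : orbit to [set: cT] (to a x) = orbit to [set: cT] a.
    by apply: orbit_act; rewrite inE.
  by case: pickP => // /(_ a); rewrite orbit_refl.
pose stab a := #|[pred x | to a x == rep a]|.
have stab_gt0 a : (0 < stab a)%N.
  have /orbitP[x _ ax] := rep_orbit a.
  by apply/card_gt0P; exists x; rewrite inE ax.
have stabE a x : stab (to a x) = stab a.
  rewrite /stab -!sum1_card [RHS](reindex_inj (mulgI x)) /=.
  by apply: eq_bigl => y; rewrite !inE repE actM.
have /choice[root rootK] :
    forall a, exists w : V, w *+ stab a = f a by move=> a; apply: Vdiv.
exists [ffun a => if a == rep a then root a else 0]; rewrite (normC_sum Ct).
apply/ffunP=> a; rewrite sum_ffunE.
have /orbitP[x0 _ ax0] := rep_orbit a.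
transitivity (\sum_(x | to a x == rep a) root (rep a)).
  rewrite [RHS]big_mkcond /=; apply: eq_bigr => x _; rewrite !ffunE repE.
  by case: eqP => // ->.
by rewrite sumr_const -/(stab a) -(stabE a x0) ax0 rootK -ax0 fE.
Qed.
End NormOfFunctions.

(** * 2-cocycles of an abelian group with trivial action *)

Section TrivialCocycles.
Local Open Scope ring_scope.
Variables (gT : finGroupType) (abG : abelian [set: gT]) (D : zmodType).
Implicit Types (s : {ffun gT * gT -> D}) (a b c : gT).
Local Notation M := (gmod_triv gT D).

Lemma abelian_mulC : commutative (@mulg gT).
Proof. by move=> a b; move/centsP: abG; apply; rewrite inE. Qed.

Lemma cocycle2_1l s a : s \in cocycle2 M -> s (1%g, a) = s (1%g, 1%g).
Proof. by move=> /cocycle2P/(_ 1%g 1%g a)/=; rewrite !mul1g; exact: addrI. Qed.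

(* The commutator pairing of the central extension of G by D given by s. *)
Definition alt s : {ffun gT * gT -> D} := [ffun u => s u - s (u.2, u.1)].

Lemma altB : {morph alt : s r / s - r}.
Proof.
by move=> s r; apply/ffunP=> -[a b]; rewrite !ffunE /= !opprD opprK addrACA.
Qed.

Lemma alt_cobound f : alt (cobound M f) = 0.
Proof.
apply/ffunP=> -[a b]; rewrite !ffunE /= [(a * b)%g]abelian_mulC.
by rewrite [f b - _ + _]addrAC [f a - _ + _]addrAC [f b + _]addrC subrr.
Qed.

Lemma altC s a b : alt s (a, b) = - alt s (b, a).
Proof. by rewrite !ffunE opprB. Qed.

(** Add the cocycle identities at (a, b, c) and (c, a, b), subtract the one at (a, c, b), and use
    that G is commutative. *)
Lemma altMl s a b c : s \in cocycle2 M ->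
  alt s ((a * b)%g, c) = alt s (a, c) + alt s (b, c).
Proof.
move=> /cocycle2P hs; rewrite !ffunE /=.
have /= h1 := hs a b c; have /= h2 := hs c a b; have /= h3 := hs a c b.
have : s ((a * b)%g, c) + s (a, b) + (s ((c * a)%g, b) + s (c, a))
     + (s (c, b) + s (a, (c * b)%g))
   = s (b, c) + s (a, (b * c)%g) + (s (a, b) + s (c, (a * b)%g))
     + (s ((a * c)%g, b) + s (a, c)) by rewrite h1 h2 h3.
rewrite [LHS](AC (2*2*2) ((1*5*4)*(6*2*3))).
rewrite [RHS](AC (2*2*2) ((6*1*4)*(2*3*5))).
rewrite [(c * b)%g]abelian_mulC [(c * a)%g]abelian_mulC.
move=> /addIr/(canRL (addrK _))/(canRL (addrK _)) eX.
apply/eqP; rewrite subr_eq; apply/eqP.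
by rewrite eX addrACA [RHS]addrAC addrA.
Qed.

(** A bilinear map is a 2-cocycle. *)
Lemma alt_cocycle2 s : s \in cocycle2 M -> alt s \in cocycle2 M.
Proof.
move=> hs; apply/cocycle2P=> a b c /=.
rewrite [alt s (a, (_ * _)%g)]altC !altMl // opprD -!altC.
by rewrite addrCA addrC [alt s (b, c) + _]addrC.
Qed.

Lemma altXl s a b n : s \in cocycle2 M ->
  alt s ((a ^+ n)%g, b) = alt s (a, b) *+ n.
Proof.
move=> hs; elim: n => [|n IHn]; last by rewrite expgS altMl // IHn mulrS.
by apply: (addrI (alt s (1%g, b))); rewrite expg0 -altMl // mulg1 addr0.
Qed.

Section Extension.
Variables (s : {ffun gT * gT -> D}) (hs : s \in cocycle2 M).
Hypothesis s_sym : forall a b, s (a, b) = s (b, a).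

(** The underlying set of the extension of G by D with factor set s, an abelian group because s is
    symmetric. As s need not be normalized, its neutral element is (- s(1, 1), 1). *)
Definition cocycle_ext : Type := (D * gT)%type.
Implicit Types u v w : cocycle_ext.
HB.instance Definition _ := Choice.on cocycle_ext.
Definition ext_add u v : cocycle_ext :=
  (u.1 + v.1 + s (u.2, v.2), (u.2 * v.2)%g).
Definition ext_zero : cocycle_ext := (- s (1%g, 1%g), 1%g).
Definition ext_opp u : cocycle_ext :=
  (- u.1 - s (u.2^-1%g, u.2) - s (1%g, 1%g), u.2^-1%g).
Lemma ext_addA : associative ext_add.
Proof.
move=> [d a] [e b] [f c]; rewrite /ext_add /= mulgA; congr (_, _).
rewrite [LHS](AC ((1*3)*1) ((1*2*3)*(4*5))) [RHS](AC 5 ((1*2*4)*(5*3))) /=.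
by move/cocycle2P: hs => ->.
Qed.
Lemma ext_addC : commutative ext_add.
Proof.
move=> [d a] [e b]; rewrite /ext_add /= abelian_mulC s_sym.
by rewrite [d + e]addrC.
Qed.
Lemma ext_add0 : left_id ext_zero ext_add.
Proof.
move=> [d a]; rewrite /ext_add /= mul1g (cocycle2_1l a hs).
by rewrite addrAC addNr add0r.
Qed.
Lemma ext_addN : left_inverse ext_zero ext_opp ext_add.
Proof.
move=> [d a]; rewrite /ext_add /= mulVg /ext_zero; congr (_, _).
by rewrite [LHS](AC (3*1*1) ((1*4)*(2*5)*3)) /= !addNr !add0r.
Qed.
#[local] HB.instance Definition _ :=
  GRing.isZmodule.Build cocycle_ext ext_addA ext_addC ext_add0 ext_addN.

Hypothesis Ddiv : forall (d : D) n, (0 < n)%N -> exists e, e *+ n = d.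

(* P is the graph of a trivialization of s on a subgroup of G. *)
Lemma sym_cocycle_trivialize (P : set (gT * D)) :
    P (1%g, s (1%g, 1%g)) -> (forall d, P (1%g, d) -> d = s (1%g, 1%g)) ->
    (forall a b d e, P (a, d) -> P (b, e) ->
       P ((a * b^-1)%g, d - e + s ((a * b^-1)%g, b))) ->
  exists2 eta : {ffun gT -> D},
    s = cobound M eta & forall a d, P (a, d) -> eta a = d.
Proof.
move=> P1 P1inj PB.
(* The trivialization turns into a homomorphism (c, a) -> c + d to D on a subgroup of the extension.
   It extends to a retraction r of the extension onto D, and eta(a) = r(0, a). *)
pose S : set (cocycle_ext * D) :=
  [set v | exists2 d, P (v.1.2, d) & v.2 = v.1.1 + d]%classic.
have hS : partial_hom S.
  split.
  - by exists (s (1%g, 1%g)) => //=; rewrite addNr.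
  - move=> [[c a] _] [[c' b] _] [/= d Pa ->] [/= e Pb ->].
    exists (d - e + s ((a * b^-1)%g, b)); first exact: PB.
    move/cocycle2P: hs => /(_ a b^-1%g b) /=.
    rewrite mulVg [s (a, _)]s_sym (cocycle2_1l a hs) => h /=.
    rewrite [RHS](AC ((1*3*1)*3) (((1*6)*(2*7))*((8*5)*(3*4)))) /=.
    by rewrite -h -!opprD subrr addr0.
  - by move=> d [e Pe /= ->]; rewrite (P1inj _ Pe) addNr.
have [r [rB rS]] := divisible_extend Ddiv hS.
exists [ffun a => r (0, a)] => [|a d Pa]; last first.
  by rewrite ffunE (rS _ (0 + d)) ?add0r //; exists d; rewrite //= add0r.
apply/ffunP=> -[a b]; rewrite !ffunE /=.
(* Modulo the copy of D over 1, the sum of (0, a) and (0, b) is (0, ab); applying r to the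
   difference gives s(a, b). *)
have dec : ((0, a) : cocycle_ext) + (0, b)
    = ((s (a, b) - s (1%g, 1%g), 1%g) : cocycle_ext) + (0, (a * b)%g).
  rewrite -[LHS]/(_, _) -[RHS]/(_, _) /= mul1g (cocycle2_1l (a * b)%g hs).
  by rewrite !add0r addr0 subrK.
have := congr1 r dec.
rewrite !(morphBD rB) (rS (_, 1%g) (s (a, b))); last first.
  by exists (s (1%g, 1%g)); rewrite //= subrK.
by move=> e; rewrite addrAC [r (0, b) + _]addrC e addrK.
Qed.

(** Start from the trivial subgroup, on which a trivialization is forced to be s(1, 1). *)
Lemma sym_cocycle_cobound : s \in coboundary2 M.
Proof.
apply/coboundary2P.
have [//|d []//||eta -> _] :=
    @sym_cocycle_trivialize [set (1%g, s (1%g, 1%g))]%classic;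
  last by exists eta.
by move=> a b d e [-> ->] [-> ->] /=; rewrite invg1 mulg1 subrr add0r.
Qed.
End Extension.

(** The trivializations of the zero cocycle are the homomorphisms to D. *)
Lemma char_extend (Ddiv : forall (d : D) n, (0 < n)%N -> exists e, e *+ n = d)
    (P : set (gT * D)) :
    P (1%g, 0) -> (forall d, P (1%g, d) -> d = 0) ->
    (forall a b d e, P (a, d) -> P (b, e) -> P ((a * b^-1)%g, d - e)) ->
  exists2 psi : {ffun gT -> D},
    forall a b, psi (a * b)%g = psi a + psi b
  & forall a d, P (a, d) -> psi a = d.
Proof.
move=> P1 P1inj PB; pose s0 : {ffun gT * gT -> D} := 0.
have hs0 : s0 \in cocycle2 M by apply: (rpred0 (cocycle2 M)).
have s0E u : s0 u = 0 by rewrite ffunE.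
have s0_sym a b : s0 (a, b) = s0 (b, a) by rewrite !s0E.
have [|d|a b d e Pa Pb|psi psi0 psiP] :=
    @sym_cocycle_trivialize s0 hs0 s0_sym Ddiv P; rewrite ?s0E ?addr0 //.
- exact: P1inj.
- exact: PB.
exists psi => // a b; have := congr1 (fun f : {ffun _ -> D} => f (a, b)) psi0.
rewrite s0E ffunE /= addrAC [psi b + _]addrC => /esym/eqP.
by rewrite subr_eq0 => /eqP.
Qed.
End TrivialCocycles.

(** * The connecting homomorphism *)

Section Connecting.
Local Open Scope ring_scope.
Variables (cT : finGroupType) (cC : commutative (@mulg cT)).
Variables (F W : gmodule cT) (A : zmodClosed F).
Hypothesis Aact : forall x v, v \in A -> x ∙ v \in A.
Variable d : F -> W.
Hypothesis dB : {morph d : u v / u - v}.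
Hypothesis d_act : forall x v, d (x ∙ v) = x ∙ d v.
Hypothesis d_eq0 : forall v, d v = 0 <-> v \in A.
Local Notation MA := (gmod_sub Aact).

Definition H2_pi (c : gmod_sub (coef_act_cocycle2 cC (M := MA))) :
    H2_coef cC MA :=
  quot_pi (relpred_act (coef_act_coboundary2 cC (M := MA))) c.

(* The connecting homomorphism from Z^1(C, F / A) to H^2(C, A), as a relation;
   d identifies F / A with a submodule of W. *)
Definition connecting (tau : {ffun cT -> W}) (q : H2_coef cC MA) : Prop :=
  exists (eta : {ffun cT -> F}) (c : gmod_sub (coef_act_cocycle2 cC (M := MA))),
    [/\ forall x, tau x = d (eta x),
        forall u, submod_val (submod_val c u) = cobound F eta u & H2_pi c = q].

Let dD := morphBD dB.

Lemma H2_pi_eq0 c : H2_pi c = 0 <-> submod_val c \in coboundary2 MA.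
Proof. exact: quot_pi_eq0. Qed.

(** The coboundary of eta has values in A because d maps it to the coboundary of the cocycle tau,
    which is 0. *)
Lemma connecting_of_lift tau (eta : {ffun cT -> F}) :
    tau \in cocycle1 W -> (forall x, tau x = d (eta x)) ->
  exists q, connecting tau q.
Proof.
move=> /cocycle1P htau tauE.
have hA u : cobound F eta u \in A.
  apply/d_eq0; case: u => x y; rewrite ffunE /= dD dB d_act.
  by rewrite -!tauE htau opprD addrCA subrr addr0 addNr.
pose c : {ffun cT * cT -> MA} := [ffun u => Submod (hA u)].
have hc : c \in cocycle2 MA.
  apply/cocycle2P=> x y z; apply: val_inj => /=.
  rewrite ![c _]ffunE /=; exact: (cocycle2P _ (cobound_cocycle2 eta)).
pose c' : gmod_sub (coef_act_cocycle2 cC (M := MA)) :=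
    @Submod cT (gmod_ffun (cT * cT)%type MA) _ c hc.
by exists (H2_pi c'), eta, c'; split=> // u; rewrite ffunE.
Qed.

Lemma connecting_cocycle1 tau q : connecting tau q -> tau \in cocycle1 W.
Proof.
move=> [eta [c [tauE cE _]]]; apply/cocycle1P=> x y.
have /d_eq0 := valP (submod_val c (x, y)); rewrite /= cE ffunE /= dD dB d_act.
by rewrite -!tauE => /eqP; rewrite addrAC subr_eq0 addrC => /eqP.
Qed.

Lemma connecting_surj q :
    (forall c, c \in cocycle2 F -> exists f, c = cobound F f) ->
  exists tau, connecting tau q.
Proof.
move=> F2; have [c <-] := quot_pi_surj q.
have [|eta eta_c] := F2 [ffun u => submod_val (submod_val c u)].
  apply/cocycle2P=> x y z; rewrite !ffunE.
  by have /cocycle2P/(_ x y z)/(congr1 val) := valP c.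
exists [ffun x => d (eta x)], eta, c; split=> // [x|u]; first by rewrite ffunE.
by rewrite -eta_c ffunE.
Qed.

Lemma connectingB tau tau' q q' : connecting tau q -> connecting tau' q' ->
  connecting (tau - tau') (q - q').
Proof.
move=> [eta [c [tauE cE <-]]] [eta' [c' [tauE' cE' <-]]].
exists (eta - eta'), (c - c'); split=> [x|u|]; last exact: quot_piB.
  by rewrite !ffunE dB tauE tauE'.
have -> : submod_val (submod_val (c - c') u)
    = submod_val (submod_val c u) - submod_val (submod_val c' u).
  by rewrite /= !ffunE.
by rewrite cE cE' coboundB !ffunE.
Qed.

Lemma connecting_act x tau q : connecting tau q ->
  connecting (x ∙ (tau : gmod_ffun cT W)) (x ∙ q).
Proof.
move=> [eta [c [tauE cE <-]]]; exists [ffun y => x ∙ eta y], (x ∙ c).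
split=> [y|u|]; last exact: quot_pi_act.
  by rewrite !ffunE d_act tauE.
rewrite !ffunE /= ?ffunE /= cE !ffunE /= gmactD gmactB -!gmactM.
by rewrite [(u.1 * x)%g]cC.
Qed.

(** If c is the coboundary of an A-valued f, then eta - f is a 1-cocycle that still lifts tau.
    Conversely, eta differs from a lift that is a cocycle by an A-valued cochain with coboundary
    c. *)
Lemma connecting_eq0 tau q : connecting tau q -> q = 0 <->
  exists2 eta, eta \in cocycle1 F & forall x, tau x = d (eta x).
Proof.
move=> [eta [c [tauE cE <-]]]; rewrite H2_pi_eq0; split.
  move=> /coboundary2P[f fE].
  exists (eta - [ffun x => submod_val (f x)]) => [|x]; last first.
    rewrite !ffunE dB tauE; apply/eqP; rewrite eq_sym subr_eq addrC -subr_eq.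
    by rewrite subrr eq_sym; apply/eqP/d_eq0/(valP (f x)).
  apply/cocycle1P=> x y.
  have := cE (x, y); rewrite fE !ffunE /= => e; rewrite gmactB.
  apply/esym/eqP; rewrite -subr_eq0 opprB; apply/eqP.
  rewrite [LHS](AC (2*2*2) ((3*6*1)*(4*5*2))) /= -e.
  by rewrite [LHS](AC (3*3) ((1*4)*(2*5)*(3*6))) /= !(subrr, addNr) !addr0.
move=> [eta' heta' tauE'].
apply/coboundary2P.
have hA x : eta x - eta' x \in A by apply/d_eq0; rewrite dB -tauE -tauE' subrr.
exists [ffun x => Submod (hA x)].
apply/ffunP=> -[x y]; apply: val_inj => /=; rewrite cE !ffunE /= gmactB.
move/cocycle1P: heta' => ->.
rewrite opprB [RHS](AC (2*(2*1)*2) ((1*5*6)*((4*2)*(3*7)))) /=.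
by rewrite !subrr !addr0.
Qed.
End Connecting.

(** * Characters, norms and coboundaries on G *)

Section Matched.
Local Open Scope ring_scope.
Variables (k : closedFieldType) (gT cT : finGroupType).
Hypothesis abG : abelian [set: gT].
Variables (t : cT) (Ct : [set: cT] = <[t]>%g).
Variable to : groupAction [set: cT] [set: gT].
Local Notation FG := (funG k to).
Local Notation FGG := (funGG k to).
Local Notation cC := (cyclic_mulC Ct).
Local Notation chars := (@charpred k cT gT to).
Local Notation cob := (cobound (ktriv k gT)).
Local Notation N := (Defs.normC t).
Implicit Types (f chi : FG) (s : FGG).

Lemma charpred_1 f : f \in chars -> f 1%g = 0.
Proof.
move=> /Defs.charP/(_ 1%g 1%g)/eqP.
by rewrite mulg1 -subr_eq subrr eq_sym => /eqP.
Qed.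

Lemma charpredV f a : f \in chars -> f a^-1%g = - f a.
Proof.
move=> hf; apply/eqP; rewrite -addr_eq0 -(Defs.charP _ hf) mulVg.
by rewrite charpred_1.
Qed.

Lemma cobB (f g : FG) : cob (f - g) = cob f - cob g :> FGG.
Proof. exact: (@coboundB _ (ktriv k gT) f g). Qed.

Lemma cob_eq0 f : (cob f : FGG) = 0 <-> f \in chars.
Proof.
split=> [f0|/Defs.charP fM].
  apply/Defs.charP=> a b; have := congr1 (fun s : FGG => s (a, b)) f0.
  rewrite !ffunE /= addrAC [f b + _]addrC => /eqP.
  by rewrite subr_eq0 eq_sym => /eqP.
by apply/ffunP=> -[a b]; rewrite !ffunE /= fM addrAC [f b + _]addrC subrr.
Qed.

Lemma cob_normC f : cob (N f) = N (cob f : FGG) :> FGG.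
Proof.
exact: (@normC_morph _ _ FG FGG cob f cobB (@cobound_act k cT gT to)).
Qed.

Lemma act_fixed (M : gmodule cT) (m : M) : t ∙ m = m -> forall x, x ∙ m = m.
Proof.
move=> tm; apply: (cyclic_ind Ct) => [|x IHx]; first exact: gmact1.
by rewrite gmactM tm.
Qed.

Lemma norm_funG_surj f : (forall x, x ∙ f = f) -> exists h, N h = f.
Proof. by apply: (norm_precomp_surj Ct); exact: kunit_divisible. Qed.

Lemma to1 x : to 1%g x = 1%g.
Proof. by apply: (mulgI (to 1%g x)); rewrite -gactmM !mulg1. Qed.
Lemma toV a x : to a^-1%g x = (to a x)^-1%g.
Proof. by apply: (mulgI (to a x)); rewrite -gactmM !mulgV to1. Qed.

(* Duality: the image of t - 1 on characters is the annihilator of its kernel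
   on G. *)
Lemma char_subr_image chi : chi \in chars ->
    (forall a, to a t = a -> chi a = 0) ->
  exists2 psi : FG, psi \in chars & chi = t ∙ psi - psi.
Proof.
move=> hchi chi0.
(* The prescribed value of psi at (t a) a^-1 is chi(a), well defined because chi vanishes on the
   t-fixed points. *)
pose P := [set v | exists a, v = ((to a t * a^-1)%g, chi a)]%classic.
have [|d [a [/esym/eqP]]|a b d e [a' [-> ->]] [b' [-> ->]]|psi psiM psiP] :=
    @char_extend _ abG _ (@kunit_divisible k) P.
- by exists 1%g; rewrite to1 mulgV charpred_1.
- by rewrite -eq_mulgV1 => /eqP/chi0 -> ->.
- exists (a' * b'^-1)%g; rewrite (Defs.charP _ hchi) charpredV // gactmM toV.
  congr (_, _); rewrite !invMg !invgK -!mulgA; congr (_ * _)%g.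
  by rewrite [LHS](abelian_mulC abG) [(b' * _)%g](abelian_mulC abG) mulgA.
have hpsi : (psi : FG) \in chars by apply/Defs.charP.
exists psi => //; apply/ffunP=> a; rewrite !ffunE -(charpredV _ hpsi) -psiM.
by rewrite (psiP _ (chi a)) //; exists a.
Qed.

Lemma normC0_cohomologous s : N s \in coboundary2 (ktriv k gT) ->
  exists f, N (s - cob f) = 0.
Proof.
move=> /coboundary2P[eta Ns].
(* t eta - eta is a character: its coboundary is t (N s) - N s = 0. *)
have [|a ta|psi hpsi eta_psi] := @char_subr_image (t ∙ (eta : FG) - eta).
- by apply/cob_eq0; rewrite cobB cobound_act -Ns act_normC // subrr.
- by rewrite !ffunE ta subrr.
have [|h Nh] := @norm_funG_surj ((eta : FG) - psi).
  apply: act_fixed; rewrite gmactB; apply/eqP; rewrite subr_eq addrAC eq_sym.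
  by rewrite -addrA -eta_psi addrC subrK.
exists h; rewrite normCB // -cob_normC Nh cobB Ns.
by rewrite ((cob_eq0 _).2 hpsi) subr0 subrr.
Qed.

Lemma alt_eq0_cobound s : s \in cocycle2 (ktriv k gT) -> alt s = 0 ->
  s \in coboundary2 (ktriv k gT).
Proof.
move=> hs alt0; apply: sym_cocycle_cobound => //; last exact: kunit_divisible.
move=> a b; apply/eqP; rewrite -subr_eq0.
have := congr1 (fun r : {ffun _ -> _} => r (a, b)) alt0.
by rewrite !ffunE => ->.
Qed.

(** * The exact sequence for H^2_c *)

Local Notation theta :=
  (@connecting cT cC FG FGG _ (@charpred_act k cT gT to) cob).
Local Notation H2chars := (H2_coef cC (dualG k to)).
Local Notation Z2 := (gmod_sub (Z2c_act cC : forall x tau,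
  tau \in @Z2c k cT gT to -> x ∙ tau \in @Z2c k cT gT to)).

(** By tau(x t) = tau(x) + x tau(t), all values of tau are coboundaries as soon as tau(t) is. *)
Lemma connecting_lift (tau : {ffun cT -> FGG}) : tau \in cocycle1 FGG ->
  tau t \in coboundary2 (ktriv k gT) -> exists q, theta tau q.
Proof.
move=> htau /coboundary2P[f ft].
have /choice[g gE] : forall x, exists f : FG, tau x = cob f.
  apply: (cyclic_ind Ct) => [|x [f' fx]].
    by exists 0; rewrite (cocycle1_1 htau) cobound0.
  exists (f' + x ∙ (f : FG)); move/cocycle1P: htau => ->.
  rewrite fx ft -cobound_act.
  exact: esym (@coboundD _ (ktriv k gT) _ _).
pose eta : {ffun cT -> FG} := [ffun x => g x].
have tauE x : tau x = cob (eta x) by rewrite ffunE.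
exact: (connecting_of_lift cC _ cobB (@cobound_act k cT gT to) cob_eq0
          htau tauE).
Qed.

Let thetaB := connectingB (cC := cC) (F := FG) (W := FGG) (d := cob)
  (Aact := @charpred_act k cT gT to) cobB.
Let theta_act := connecting_act (cC := cC) (F := FG) (W := FGG) (d := cob)
  (Aact := @charpred_act k cT gT to) (@cobound_act k cT gT to).
Let theta_eq0 := connecting_eq0 (cC := cC) (F := FG) (W := FGG) (d := cob)
  (Aact := @charpred_act k cT gT to) cobB cob_eq0.
Let theta_cocycle1 := connecting_cocycle1 (cC := cC) (F := FG) (W := FGG)
  (d := cob) (Aact := @charpred_act k cT gT to) cobB (@cobound_act k cT gT to)
  cob_eq0.

Lemma theta_surj q : exists tau, theta tau q.
Proof.
apply: connecting_surj => c; apply: (cocycle2_cyclic_cobound Ct).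
exact: norm_funG_surj.
Qed.

Lemma theta0_inj q : theta 0 q -> q = 0.
Proof.
move=> th; apply/(theta_eq0 th); exists 0 => [|x]; first exact: rpred0.
by rewrite !ffunE cobound0.
Qed.

(** With [theta0_B2c], this identifies B^2_c as the kernel of the connecting map. *)
Lemma theta_B2c tau : tau \in @B2c k cT gT to -> theta tau 0.
Proof.
move=> tauB; have /andP[tau1 _] := B2c_sub tauB.
have /asboolP[eta heta tauE] := tauB.
have tauE' x : tau x = cob (eta x) by rewrite tauE ffunE.
have tB : tau t \in coboundary2 (ktriv k gT).
  by apply/coboundary2P; exists (eta t); apply: tauE'.
have [q th] := connecting_lift tau1 tB.
have q0 : q = 0 by apply/(theta_eq0 th); exists eta.
by rewrite q0 in th.
Qed.

Lemma theta0_B2c tau : theta tau 0 -> tau \in @B2c k cT gT to.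
Proof.
move=> th; have [eta heta tauE] := (theta_eq0 th).1 erefl.
by apply/asboolP; exists eta => //; apply/ffunP=> x; rewrite ffunE tauE.
Qed.

Lemma theta_Z2c tau q : theta tau q -> tau \in @Z2c k cT gT to.
Proof.
move=> th; apply/andP; split; first exact: theta_cocycle1 th.
case: th => eta [c [tauE _ _]]; apply/forallP=> x; rewrite tauE.
exact: (@cobound_cocycle2 _ (ktriv k gT) (eta x)).
Qed.

(* On classes, r retracts H^2_c onto the kernel H^2(C, Hom(G, k^x)) of
   H^2_c -> H^2(G, k^x). *)
Definition is_retraction (r : Z2 -> H2chars) :=
  [/\ {morph r : u v / u - v}, forall x u, r (x ∙ u) = x ∙ r u
    & forall (u : Z2) q, theta (submod_val u) q -> r u = q].

(** * The retraction when |G| is odd *)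

Lemma retraction_of_section (sigma : FGG -> FGG) :
    {morph sigma : s s' / s - s'} ->
    (forall x s, sigma (x ∙ s) = x ∙ sigma s) ->
    (forall f, sigma (cob f) = 0) ->
    (forall s, s \in cocycle2 (ktriv k gT) ->
       s - sigma s \in coboundary2 (ktriv k gT)) ->
  exists r, is_retraction r.
Proof.
move=> sB s_act s_cob s_sec.
(* Subtracting [sigma] leaves a 1-cocycle whose values are coboundaries, so the connecting map
   applies to it. Cocycles whose values were coboundaries already are unchanged, since [sigma] kills
   these. *)
pose R (u : Z2) : {ffun cT -> FGG} :=
  [ffun x => submod_val u x - sigma (submod_val u x)].
have R1 (u : Z2) : R u \in cocycle1 FGG.
  have /andP[/cocycle1P hu _] := valP u.
  apply/cocycle1P=> x y; rewrite !ffunE hu (morphBD sB) s_act gmactB.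
  by rewrite opprD addrACA.
have RB u v : R (u - v) = R u - R v.
  by apply/ffunP=> x; rewrite !ffunE sB !opprD addrACA.
have R0 : R 0 = 0 := morphB0 RB.
have uniq_theta tau q q' : theta tau q -> theta tau q' -> q = q'.
  move=> th th'; apply/eqP; rewrite -subr_eq0; apply/eqP/theta0_inj.
  by have := thetaB th th'; rewrite subrr.
pose S := [set v : Z2 * H2chars | theta (R v.1) v.2]%classic.
have hS : partial_hom S.
  split=> [|[u q] [v q'] /= hu hv|q /=].
  - by rewrite /S /= R0; apply/theta_B2c/rpred0.
  - by rewrite /S /= RB; apply: thetaB.
  - by rewrite /S /= R0; apply: theta0_inj.
have [|r [rB rS]] := partial_hom_total hS.
  move=> u; have [|q th] := connecting_lift (R1 u); last by exists q.
  by rewrite ffunE; have /andP[_ /forallP/(_ t)/s_sec] := valP u.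
exists r; split=> // [x u|u q th].
  apply: uniq_theta (rS _) _ => /=.
  have -> : R (x ∙ u) = x ∙ (R u : gmod_ffun cT FGG).
    by apply/ffunP=> y; rewrite !ffunE s_act gmactB.
  exact: theta_act (rS u).
apply: uniq_theta (rS u) _ => /=.
suff -> : R u = submod_val u by [].
case: th => eta [c [uE _ _]].
by apply/ffunP=> x; rewrite ffunE uE s_cob subr0.
Qed.

Lemma retraction_odd : odd #|[set: gT]| -> exists r, is_retraction r.
Proof.
(* h inverts 2 modulo |G|, and |G| kills the values of [alt s]. *)
move=> oddG; pose h := #|[set: gT]|.+1./2.
apply: (@retraction_of_section (fun s => alt s *+ h)).
- by move=> s s'; rewrite altB mulrnBl.
- move=> x s; have -> : alt (x ∙ s) = x ∙ (alt s : FGG).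
    by apply/ffunP=> -[a b]; rewrite !ffunE.
  elim: h => [|n IHn]; first by rewrite !mulr0n gmact0.
  by rewrite !mulrS gmactD IHn.
- by move=> f; rewrite (alt_cobound abG) mul0rn.
move=> s hs.
have altG u : alt s u *+ #|[set: gT]| = 0.
  case: u => a b; rewrite -(altXl abG _ _ _ hs) expg_cardG ?inE //.
  by rewrite -(expg0 a) (altXl abG _ _ _ hs).
(* As [alt (alt s)] is twice [alt s], the pairing of the difference is (1 - 2h) [alt s] = - |G|
   [alt s] = 0. *)
apply: alt_eq0_cobound.
  have altZ : alt s \in Z2G k to by apply: alt_cocycle2.
  exact: rpredB (hs : s \in Z2G k to) (rpredMn h altZ).
have altMn u : (alt s *+ h : FGG) u = alt s u *+ h by rewrite ffunMnE.
have h2 : (h * 2 = #|[set: gT]|.+1)%N by rewrite muln2 halfK /= oddG.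
apply/ffunP=> -[a b]; rewrite !ffunE /=.
rewrite !altMn [alt s (b, a)]altC mulNrn opprK opprD addrACA -opprD -mulr2n.
by rewrite -mulrnA h2 mulrS altG addr0 ![in LHS]ffunE /= subrr.
Qed.

(** * The retraction when p = 2 *)

Lemma normC2 (M : gmodule cT) (m : M) : #[t]%g = 2 -> N m = m + t ∙ m.
Proof.
by move=> t2; rewrite /Defs.normC t2 !big_ord_recr big_ord0 /= add0r gmact1.
Qed.

(** u(t) + t u(t) = u(t^2) = 0, and a 1-cocycle is determined by its value at t. *)
Lemma Z2c_act_order2 (u : Z2) : #[t]%g = 2 -> t ∙ u = - u.
Proof.
move=> t2; have /andP[u1 _] := valP u.
apply/eqP; rewrite -addr_eq0 addrC; apply/eqP/val_inj/(cocycle1_inj Ct).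
- exact: (rpredD u1 (cocycle1_act cC t u1)).
- exact: (rpred0 (cocycle1 FGG)).
have e := cocycle1_cycle t u1; rewrite normC2 // in e.
by rewrite [RHS]ffunE -e ffunE [X in _ + X]ffunE.
Qed.

(** Extend the connecting map from its domain to all of Z^2_c. It takes the value 0 on all doubles;
    hence if u is outside the domain of an extension, so are its odd multiples, and u may be sent to
    0. Equivariance is automatic, since t acts by -1 on both sides. *)
Lemma retraction_two : #[t]%g = 2 ->
    (forall u : Z2, submod_val (u *+ 2) \in @B2c k cT gT to) ->
  exists r, is_retraction r.
Proof.
move=> t2 uB.
pose S := [set v : Z2 * H2chars | theta (submod_val v.1) v.2]%classic.
have hS : partial_hom S.
  split=> [|[u q] [v q'] /= hu hv|q].
  - exact/theta_B2c/rpred0.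
  - exact: thetaB hu hv.
  - exact: theta0_inj.
have [|r [rB rS]] := partial_hom_extend hS.
  move=> S' hS' sub u.
  have u2 n : S' ((u *+ 2) *+ n, 0).
    have Su2 : S' (u *+ 2, 0) by apply: sub; apply/theta_B2c/uB.
    by have := partial_homMn n hS' Su2; rewrite mul0rn.
  have [[q Su]|nSu] := pselect (exists q, S' (u, q)).
    exists q => n e Se; apply: (partial_hom_inj hS' Se).
    exact: partial_homMn.
  exists 0 => n e; rewrite mul0rn -(odd_double_half n) -mul2n mulrnDr mulrnA.
  case: (odd n) => Se; last first.
    by apply: (partial_hom_inj hS' Se); rewrite mulr0n add0r; apply: u2.
  case: nSu; exists e; case: hS' => _ S'B _.
  have <- : (u *+ 1 + u *+ 2 *+ n./2, e) - (u *+ 2 *+ n./2, 0) = (u, e).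
    by rewrite -[LHS]/(_, _) /= addrK subr0.
  exact: S'B Se (u2 _).
(* The action by -1 passes from Z^2_c to H^2(C, Hom(G, k^x)) through the surjective connecting
   map. *)
have qN (q : H2chars) : t ∙ q = - q.
  have [tau th] := theta_surj q.
  pose u : Z2 := Submod (theta_Z2c th).
  have tauN : t ∙ (tau : gmod_ffun cT FGG) = - tau.
    exact: (congr1 val (Z2c_act_order2 u t2)).
  have := thetaB (theta_act t th) (thetaB (theta_B2c (rpred0 _)) th).
  rewrite tauN sub0r subrr sub0r opprK => /theta0_inj/eqP.
  by rewrite addr_eq0 => /eqP.
exists r; split=> //.
apply: (cyclic_ind Ct) => [|x IHx] u; first by rewrite !gmact1.
by rewrite !gmactM IHx Z2c_act_order2 // qN (morphBN rB).
Qed.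

Lemma normC0_double s : (forall a : gT, a * a = 1)%g -> #[t]%g = 2 ->
    s \in cocycle2 (ktriv k gT) -> N s = 0 ->
  exists2 f : FG, N f = 0 & s *+ 2 = cob f.
Proof.
move=> G2 t2 hs Ns.
have sMn u : (s *+ 2 : FGG) u = s u *+ 2 by rewrite ffunMnE.
have alt1 b : alt s (1%g, b) = 0 by rewrite -(expg0 1%g) (altXl abG _ _ _ hs).
have hs2 : s *+ 2 \in Z2G k to by apply: rpredMn.
have /coboundary2P[eta etaE] : s *+ 2 \in coboundary2 (ktriv k gT).
  apply: alt_eq0_cobound hs2 _.
  apply/ffunP=> -[a b]; rewrite [LHS]ffunE /= !sMn -mulrnBl.
  have -> : s (a, b) - s (b, a) = alt s (a, b) by rewrite ffunE.
  by rewrite -(altXl abG _ _ _ hs) expgS expg1 G2 alt1 ffunE.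
have s_fix a : to a t = a -> s (a, a) *+ 2 = 0.
  move=> ta; have := congr1 (fun s : FGG => s (a, a)) Ns.
  by rewrite normC2 // !ffunE /= /pair_act /= ta.
(* As a a = 1, the coboundary of eta at (a, a) is 2 eta(a) - eta(1). *)
have etaEa a : eta a *+ 2 = s (a, a) *+ 2 + eta 1%g.
  have := congr1 (fun s : FGG => s (a, a)) etaE.
  by rewrite sMn ffunE /= G2 => ->; rewrite addrAC subrK.
have eta1 : eta 1%g = 0.
  have /eqP := etaEa 1%g; rewrite s_fix ?to1 // add0r mulr2n.
  by rewrite -subr_eq0 addrK => /eqP.
have [|a ta|psi hpsi psiE] := @char_subr_image (N (eta : FG)).
- apply/cob_eq0; rewrite cob_normC -etaE.
  by rewrite mulr2n normC2 // gmactD addrACA -normC2 // Ns addr0.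
- rewrite normC2 // !ffunE ta -mulr2n etaEa s_fix // eta1.
  by rewrite addr0.
exists ((eta : FG) - psi); last first.
  by rewrite cobB ((cob_eq0 _).2 hpsi) subr0.
(* Characters of an elementary 2-group have order at most 2, so t psi - psi = N psi. *)
have psiN : - psi = psi.
  apply/eqP; rewrite eq_sym -addr_eq0; apply/eqP/ffunP=> a.
  by rewrite !ffunE -(Defs.charP _ hpsi) G2 charpred_1.
by rewrite normCB // psiE [N psi]normC2 // psiN [t ∙ psi + _]addrC subrr.
Qed.

(** Write 2 u(t) = d f with N f = 0. Then f = eta(t) for a 1-cocycle eta, and 2 u equals [delta eta]
    because both agree at t. *)
Lemma retraction_elementary : (forall a : gT, a * a = 1)%g -> #[t]%g = 2 ->
  exists r, is_retraction r.
Proof.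
move=> G2 t2; apply: retraction_two => // u.
have /andP[u1 /forallP/(_ t) ut] := valP u.
have [f Nf ft] := normC0_double G2 t2 ut (cocycle1_cycle t u1).
have [eta heta etat] := cocycle1_of_normC0 Ct Nf.
have hB : delta eta \in @B2c k cT gT to by apply/asboolP; exists eta.
suff -> : submod_val (u *+ 2) = delta eta by [].
have /andP[deta1 _] := B2c_sub hB.
apply: (cocycle1_inj Ct) deta1 _; first by have /andP[] := valP (u *+ 2).
by rewrite [RHS]ffunE etat -ft !mulr2n ffunE.
Qed.

Lemma retraction_trivial : (forall a x, to a x = a) -> #[t]%g = 2 ->
  exists r, is_retraction r.
Proof.
move=> triv t2; apply: retraction_two => // u.
suff -> : submod_val (u *+ 2) = 0 by exact: rpred0.
have tu : t ∙ u = u.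
  apply/val_inj/ffunP=> x; rewrite ffunE; apply/ffunP=> -[a b].
  by rewrite ffunE /= /pair_act /= !triv.
by rewrite mulr2n -[u in u + _]tu Z2c_act_order2 // addNr.
Qed.

(** * The isomorphism *)

Let ZG := gmod_sub (@funGG_act_cocycle2 k cT gT to : forall x s,
  s \in Z2G k to -> x ∙ s \in Z2G k to).
Let piG (s : ZG) : H2G k to := quot_pi (relpred_act (V := FGG) (Z := Z2G k to)
  (B := B2G k to) (@funGG_act_coboundary2 k cT gT to)) s.

Let piGB : {morph piG : s s' / s - s'}.
Proof. exact: quot_piB. Qed.

Let piG_act x (s : ZG) : piG (x ∙ s) = x ∙ piG s.
Proof. exact: quot_pi_act. Qed.

Let piG_eq (s s' : ZG) : piG s = piG s' <->
  submod_val s - submod_val s' \in coboundary2 (ktriv k gT).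
Proof. exact: quot_pi_eq. Qed.

Let piG_eq0 (s : ZG) :
  piG s = 0 <-> submod_val s \in coboundary2 (ktriv k gT).
Proof. exact: quot_pi_eq0. Qed.

Lemma eval_cocycle2 (u : Z2) : submod_val u t \in Z2G k to.
Proof. by have /andP[_ /forallP] := valP u. Qed.

Definition eval_t (u : Z2) : ZG := Submod (eval_cocycle2 u).

Lemma piG_normker (s : ZG) :
  piG s \in normker t (M := H2G k to) <->
  N (submod_val s) \in coboundary2 (ktriv k gT).
Proof.
have -> : N (submod_val s) = submod_val (N s).
  by rewrite (@normC_morph _ t ZG FGG (@submod_val _ _ _)).
rewrite -piG_eq0 (@normC_morph _ t ZG (H2G k to) piG) //.
by split=> /eqP.
Qed.

(** The map sends u to r(u) and the class of u(t). If that class is 0, then u is in the domain of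
    the connecting map with value r(u), so r(u) = 0 forces u into B^2_c. *)
Lemma isomorphism_of_retraction r : is_retraction r ->
  gmod_isomorphic (H2c k to cC)
    (gmod_prod H2chars (gmod_normker Ct (H2G k to))).
Proof.
case=> rB r_act rS.
have hN u : piG (eval_t u) \in normker t (M := H2G k to).
  apply/piG_normker => /=; have /andP[u1 _] := valP u.
  by rewrite (cocycle1_cycle t u1); apply: (rpred0 (B2G k to)).
pose H2N := gmod_normker Ct (H2G k to).
pose res u : H2N := @Submod _ (H2G k to) _ (piG (eval_t u)) (hN u).
have resB : {morph res : u v / u - v}.
  move=> u v; apply: val_inj => /=.
  have -> : eval_t (u - v) = eval_t u - eval_t v.
    by apply: val_inj; rewrite /= !ffunE.
  exact: piGB.
have res_act x u : res (x ∙ u) = x ∙ res u.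
  apply: val_inj => /=.
  have -> : eval_t (x ∙ u) = x ∙ eval_t u.
    by apply: val_inj; rewrite /= !ffunE.
  exact: piG_act.
apply: (@quot_iso _ _ _ _ (gmod_prod H2chars H2N) (fun u => (r u, res u))).
- by move=> u v; rewrite rB resB.
- by move=> x u; rewrite r_act res_act.
- move=> u; split=> [[ru resu]|uB].
    have ut := (piG_eq0 (eval_t u)).1 resu.
    have /andP[u1 _] := valP u; have [q th] := connecting_lift u1 ut.
    by apply: theta0_B2c; rewrite -ru (rS u q th).
  rewrite (rS u 0); last exact: theta_B2c.
  congr (_, _); apply/val_inj/(piG_eq0 (eval_t u)).2 => /=.
  have /asboolP[eta _ ->] := uB.
  by rewrite ffunE; apply/coboundary2P; exists (eta t).
case=> q [w hw]; have [s sw] := quot_pi_surj w.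
have [f Nf] : exists f, N (submod_val s - cob f) = 0.
  by apply/normC0_cohomologous/piG_normker; rewrite -[w]sw in hw.
have [tau tau1 taut] := cocycle1_of_normC0 Ct Nf.
have tauZ : tau \in @Z2c k cT gT to.
  apply/andP; split=> //; apply/forallP; apply: (cyclic_ind Ct) => [|x IHx].
    by rewrite (cocycle1_1 tau1) (rpred0 (Z2G k to)).
  move/cocycle1P: tau1 => ->; apply: (rpredD (S := Z2G k to) IHx).
  apply: funGG_act_cocycle2; rewrite taut.
  by apply: (rpredB (S := Z2G k to)); [exact: valP s | exact: cobound_cocycle2].
pose u0 : Z2 := Submod tauZ.
(* [u0] has the right second component. Adding [u1] corrects the first and keeps the second, since
   the values of tau' are coboundaries. *)
have [tau' th] := theta_surj (q - r u0).
pose u1 : Z2 := Submod (theta_Z2c th).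
exists (u1 + u0).
rewrite (morphBD rB) (rS u1 _ th) subrK; congr (_, _); apply: val_inj => /=.
rewrite -sw -[RHS]/(piG s); apply/piG_eq.
have [eta [c [tau'E _ _]]] := th.
rewrite /= !ffunE taut tau'E addrA addrAC addrK -cobB.
by apply/coboundary2P; exists ((eta t : FG) - f).
Qed.
End Matched.

Theorem proposition3p5
  (k : closedFieldType) (k_char0 : [pchar k]%R =i pred0)
  (gT : finGroupType) (G_abelian : abelian [set: gT])
  (p : nat) (p_prime : prime p) (p_dvd : p %| #|[set: gT]|)
  (p_min : forall q : nat, prime q -> q %| #|[set: gT]| -> p <= q)
  (cT : finGroupType) (t : cT) (Ct : [set: cT] = <[t]>%g) (ot : #[t]%g = p)
  (to : groupAction [set: cT] [set: gT])
  (hG : odd #|[set: gT]| \/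
        (2.-group [set: gT])%g /\
          ((forall (a : gT) (x : cT), to a x = a) \/ (2.-abelem [set: gT])%g)) :
  gmod_isomorphic
    (H2c k to (cyclic_mulC Ct))
    (gmod_prod (H2_coef (cyclic_mulC Ct) (dualG k to))
               (gmod_normker Ct (H2G k to))).
Proof.
have p2 : (2.-group [set: gT])%g -> #[t]%g = 2.
  by rewrite ot => /pgroupP/(_ p p_prime p_dvd)/eqP.
suff [r rP] : exists r, is_retraction (k := k) (Ct := Ct) (to := to) r.
  exact: isomorphism_of_retraction rP.
case: hG => [|[/p2 t2 [triv | elem]]].
- exact: retraction_odd.
- exact: retraction_trivial.
apply: retraction_elementary => // a.
by have /(abelemP (isT : prime 2))[_] := elem; apply; rewrite inE.
Qed.
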